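(* Every (finite simple) graph belongs to some minimal DSF set.
   Context: All graphs are finite and simple, considered up to isomorphism. For a set $\mathcal{F}$ of graphs, a graph is $\mathcal{F}$-free if none of its induced subgraphs is isomorphic to a member of $\mathcal{F}$. A set $\mathcal{F}$ of graphs is degree-sequence-forcing (DSF) if whenever some realization of a degree sequence $d$ (a graph with degree sequence $d$) is $\mathcal{F}$-free, every realization of $d$ is $\mathcal{F}$-free. A DSF set is minimal if no proper subset of it is DSF.
   Formalization: Since the empty set is vacuously DSF, no nonempty set would be minimal under the literal definition; here a DSF set is called minimal if no nonempty proper subset of it is DSF. *)

(* Defs.v *)
From mathcomp Require Import all_boot.

Set Implicit Arguments.
Unset Strict Implicit.
Unset Printing Implicit Defensive.

Record sgraph := SGraph {
  vertex :> finType;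
  adj : rel vertex;
  adj_sym : symmetric adj;
  adj_irrefl : irreflexive adj
}.

Definition iso (G H : sgraph) : Prop :=
  exists2 f : G -> H, bijective f & forall x y, adj (f x) (f y) = adj x y.

Section Induced.
Variables (G : sgraph) (S : {set G}).

Definition induced_adj : rel {x : G | x \in S} :=
  fun u v => adj (val u) (val v).

Lemma induced_sym : symmetric induced_adj.
Proof. by move=> u v; apply: adj_sym. Qed.

Lemma induced_irrefl : irreflexive induced_adj.
Proof. by move=> u; apply: adj_irrefl. Qed.

Definition induced : sgraph := SGraph induced_sym induced_irrefl.
End Induced.

Definition deg (G : sgraph) (x : G) : nat := #|[set y | adj x y]|.

Definition degseq (G : sgraph) : seq nat := sort geq [seq deg x | x : G].

Definition realizes (G : sgraph) (d : seq nat) : Prop := degseq G = d.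

(* Predicates rather than mathcomp.classical's [set sgraph]: sgraph quantifies
   over finType and so lives in a universe too large for [set]. *)
Definition graph_set := sgraph -> Prop.

Definition subset_of (F' F : graph_set) : Prop := forall G, F' G -> F G.

Definition proper_subset_of (F' F : graph_set) : Prop :=
  subset_of F' F /\ ~ subset_of F F'.

Definition free (F : graph_set) (G : sgraph) : Prop :=
  forall (S : {set G}) (H : sgraph), F H -> ~ iso (induced S) H.

Definition DSF (F : graph_set) : Prop :=
  forall d : seq nat,
    (exists2 G, realizes G d & free F G) ->
    forall G, realizes G d -> free F G.

(* Graphs are considered up to isomorphism: a set of graphs in the sense of
   the text is an isomorphism-invariant set of concrete graphs. *)
Definition iso_closed (F : graph_set) : Prop :=
  forall G H, iso G H -> F G -> F H.

(* The empty set satisfies DSF vacuously, so minimality is taken among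
   nonempty sets of graphs; otherwise the empty set would be the only minimal
   one. *)
Definition minimal_DSF (F : graph_set) : Prop :=
  DSF F /\
  forall F' : graph_set,
    iso_closed F' -> (exists G, F' G) -> proper_subset_of F' F -> ~ DSF F'.

(* Main.v *)
Require Import Defs.
From Stdlib Require Import Classical.
From mathcomp Require Import all_boot.

Set Implicit Arguments.
Unset Strict Implicit.
Unset Printing Implicit Defensive.

(** Call a vertex of degree at least 2 a hub, and let [F] be the set of minimal
    graphs whose degrees dominate given thresholds [g i >= 2]. Domination is
    inherited by extensions and depends on degrees only, so [F] is DSF. Adding
    to a graph [H] a matching of its darts (ordered adjacent pairs) gives the
    same degrees as the star forest that hangs each dart of [H] as a leaf at its
    source. Let [F'] be a nonempty DSF subset of [F]. If [H] is in [F'], then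
    the star forest of [H] contains a member of [F'], which must be the disjoint
    union [T] of stars with [g i] leaves. Now for every [G] in [F] the star
    forest of [G] contains [T], so [G] plus a matching contains a member [K] of
    [F']. By minimality, every vertex of [K] is a hub or next to one, so [K]
    misses the matching; hence [K] lies in [G] and is isomorphic to it. Thus
    [F'] is all of [F].

    Conversely, if every vertex of [G] is a hub or next to one, then [G] is
    minimal for the thresholds given by the degrees of its hubs. On three or
    more vertices this holds for [G] or for its complement, because it holds for
    the complement of every disconnected graph, and complementation preserves
    minimal DSF sets. On at most two vertices, [G] or its complement forms a DSF
    set by itself. *)

(** * Embeddings *)

Definition emb (G H : sgraph) : Prop :=
  exists2 f : G -> H, injective f & {mono f : x y / adj x y}.

Lemma iso_refl G : iso G G.
Proof. by exists id => //; exists id. Qed.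

Lemma iso_sym G H : iso G H -> iso H G.
Proof.
move=> [f [f' fK f'K] fA]; exists f'; first by exists f.
by move=> x y; rewrite -fA !f'K.
Qed.

Lemma iso_trans G H K : iso G H -> iso H K -> iso G K.
Proof.
move=> [f f_bij fA] [h h_bij hA].
by exists (h \o f) => [|x y /=]; [apply: bij_comp | rewrite hA fA].
Qed.

Lemma iso_emb G H : iso G H -> emb G H.
Proof. by move=> [f f_bij fA]; exists f => //; apply: bij_inj. Qed.

Lemma emb_trans G H K : emb G H -> emb H K -> emb G K.
Proof.
move=> [f f_inj fA] [h h_inj hA].
by exists (h \o f) => [|x y /=]; [apply: inj_comp | rewrite hA fA].
Qed.

Lemma emb_card G H : emb G H -> #|G| <= #|H|.
Proof. by move=> [f f_inj _]; apply: leq_card f_inj. Qed.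

Lemma emb_card_iso G H : emb G H -> #|H| <= #|G| -> iso G H.
Proof.
by move=> [f f_inj fA] leHG; exists f => //; apply: inj_card_bij.
Qed.

Lemma induced_emb (G : sgraph) (S : {set G}) : emb (induced S) G.
Proof. by exists val => //; apply: val_inj. Qed.

Lemma emb_induced (G H : sgraph) :
  emb H G -> exists S : {set G}, iso (induced S) H.
Proof.
move=> [f f_inj fA]; pose S := [set f x | x in H]; exists S; apply: iso_sym.
have fS x : f x \in S by apply: imset_f.
apply: emb_card_iso; last by rewrite card_sig -(card_imset predT f_inj).
exists (fun x => exist _ (f x) (fS x) : induced S) => [x y [] /f_inj //|x y].
exact: fA.
Qed.

(** * Degrees *)

Definition nbhd (G : sgraph) (x : G) : {set G} := [set y | adj x y].

Definition hub (G : sgraph) (x : G) : bool := 1 < deg x.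

Lemma in_nbhd (G : sgraph) (x y : G) : (y \in nbhd x) = adj x y.
Proof. by rewrite inE. Qed.

Lemma degE (G : sgraph) (x : G) : deg x = #|nbhd x|.
Proof. by []. Qed.

Lemma adj_neq (G : sgraph) (x y : G) : adj x y -> x != y.
Proof. by apply: contraTneq => ->; rewrite adj_irrefl. Qed.

Lemma deg_gt0P (G : sgraph) (x : G) : reflect (exists y, adj x y) (0 < deg x).
Proof.
by apply: (iffP card_gt0P) => -[y xy]; exists y; rewrite inE in xy *.
Qed.

Lemma nonhub_adj_eq (G : sgraph) (x y z : G) :
  ~~ hub x -> adj x y -> adj x z -> y = z.
Proof.
by rewrite -leqNgt => /card_le1_eqP eqN xy xz; apply: eqN; rewrite in_nbhd.
Qed.

Section EmbeddingDegrees.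
Variables (G H : sgraph) (f : G -> H).
Hypotheses (f_inj : injective f) (fA : {mono f : x y / adj x y}).

Lemma imset_nbhd_sub x : f @: nbhd x \subset nbhd (f x).
Proof. by apply/subsetP => _ /imsetP [y + ->]; rewrite !in_nbhd fA. Qed.

Lemma leq_deg_emb x : deg x <= deg (f x).
Proof.
by rewrite degE -(card_imset _ f_inj) subset_leq_card ?imset_nbhd_sub.
Qed.

Lemma hub_emb x : hub x -> hub (f x).
Proof. by move=> x_hub; apply: leq_trans x_hub (leq_deg_emb x). Qed.

Lemma imset_nbhd x : deg (f x) = deg x -> f @: nbhd x = nbhd (f x).
Proof.
by move=> eq_deg; apply/eqP; rewrite eqEcard imset_nbhd_sub card_imset ?eq_leq.
Qed.

Lemma deg_emb_eq x :
  (forall y, y \in nbhd (f x) -> exists z, y = f z) -> deg (f x) = deg x.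
Proof.
move=> closed_nbhd; apply/eqP; rewrite eqn_leq leq_deg_emb andbT.
rewrite !degE -(card_imset (nbhd x) f_inj).
apply/subset_leq_card/subsetP => y Ny; have [z eq_y] := closed_nbhd y Ny.
by move: Ny; rewrite eq_y in_nbhd fA (mem_imset _ _ f_inj) in_nbhd.
Qed.
End EmbeddingDegrees.

Lemma deg_induced (G : sgraph) (S : {set G}) (u : induced S) :
  nbhd (val u) \subset S -> deg (val u) = deg u.
Proof.
move/subsetP=> nbhdS.
apply: (@deg_emb_eq (induced S) G val val_inj) => // y /nbhdS yS.
by exists (exist _ y yS).
Qed.

Lemma card_degseq G H : degseq G = degseq H -> #|G| = #|H|.
Proof. by move/(congr1 size); rewrite !size_sort !size_image. Qed.

Lemma ord_bij_degseq (G : sgraph) :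
  exists2 e : 'I_#|G| -> G,
    bijective e & forall i, deg (e i) = nth 0 (degseq G) i.
Proof.
pose t := [tuple of sort (relpre (@deg G) geq) (enum_tuple G)].
exists (tnth t) => [|i].
  apply: inj_card_bij; last by rewrite card_ord.
  by apply/tuple_uniqP; rewrite sort_uniq enum_uniq.
by rewrite /degseq sort_map -tnth_map (tnth_nth 0).
Qed.

Lemma degseqP G H :
  degseq G = degseq H <->
  exists2 f : G -> H, bijective f & forall x, deg (f x) = deg x.
Proof.
split=> [eqGH|[f f_bij f_deg]].
  have [d [d' dK d'K] deg_d] := ord_bij_degseq G.
  have [e e_bij deg_e] := ord_bij_degseq H.
  exists (e \o cast_ord (card_degseq eqGH) \o d') => [|x /=].
    apply: bij_comp; last by exists d.
    by apply: bij_comp e_bij _; apply: inj_card_bij;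
      [apply: cast_ord_inj | rewrite !card_ord (card_degseq eqGH)].
  by rewrite deg_e /= -eqGH -deg_d d'K.
have perm_f : perm_eq [seq f x | x : G] (enum H).
  have [f' _ f'K] := f_bij.
  apply: uniq_perm => [||y].
  - by rewrite (map_inj_uniq (bij_inj f_bij)) enum_uniq.
  - exact: enum_uniq.
  by rewrite mem_enum; apply/mapP; exists (f' y); rewrite ?mem_enum.
have -> : degseq G = sort geq [seq deg y | y <- [seq f x | x : G]].
  by rewrite -map_comp; congr sort; apply: eq_map => x /=.
apply/perm_sortP; last exact: perm_map.
- by move=> m n; apply: leq_total.
- by move=> n m p nm pn; apply: leq_trans pn nm.
- by move=> m n; rewrite andbC; apply: anti_leq.
Qed.

(** * Degree-sequence-forcing sets *)

Definition contains (F : graph_set) (G : sgraph) : Prop :=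
  exists2 H, F H & emb H G.

Definition emb_closed (P : graph_set) : Prop :=
  forall G H, emb G H -> P G -> P H.

Definition degseq_closed (P : graph_set) : Prop :=
  forall G H, degseq G = degseq H -> P G -> P H.

Definition minimal_in (P : graph_set) : graph_set :=
  fun G => P G /\ forall H, emb H G -> P H -> #|G| <= #|H|.

Definition in_minimal_DSF (G : sgraph) : Prop :=
  exists F : graph_set, [/\ iso_closed F, minimal_DSF F & F G].

Lemma freeP F G : free F G <-> ~ contains F G.
Proof.
split=> [freeG [H FH /emb_induced [S isoSH]]|ncontG S H FH isoSH].
  exact: freeG S H FH isoSH.
apply: ncontG; exists H => //.
exact: emb_trans (iso_emb (iso_sym isoSH)) (induced_emb S).
Qed.

Lemma DSF_contains F : DSF F <-> degseq_closed (contains F).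
Proof.
split=> [dsfF G H eqGH contG|closedF d [G rG /freeP freeG] H rH].
  apply: NNPP => /freeP freeH.
  by have /freeP := dsfF _ (ex_intro2 _ _ H erefl freeH) G eqGH.
by apply/freeP => contH; apply: freeG; apply: closedF contH; rewrite rH.
Qed.

Lemma minimal_in_iso_closed P : emb_closed P -> iso_closed (minimal_in P).
Proof.
move=> P_emb G H isoGH [PG minG]; split; first exact: P_emb (iso_emb isoGH) PG.
move=> K embKH PK; have embHG := iso_emb (iso_sym isoGH).
exact: leq_trans (emb_card embHG) (minG K (emb_trans embKH embHG) PK).
Qed.

Lemma minimal_in_iso P G H : P G -> emb G H -> minimal_in P H -> iso G H.
Proof. by move=> PG embGH [_ minH]; apply/emb_card_iso/minH. Qed.

Lemma contains_minimal_in P G :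
  emb_closed P -> contains (minimal_in P) G <-> P G.
Proof.
move=> P_emb; split=> [[H [PH _] embHG]|]; first exact: P_emb PH.
have [n] := ubnP #|G|; elim: n G => // n IHn G ltGn PG.
have [[H [embHG PH ltHG]]|no_smaller] :=
  classic (exists H, [/\ emb H G, P H & #|H| < #|G|]).
  have [K minK embKH] := IHn H (leq_trans ltHG ltGn) PH.
  by exists K => //; apply: emb_trans embHG.
exists G; last exact/iso_emb/iso_refl.
split=> // H embHG PH; rewrite leqNgt; apply/negP => ltHG.
by apply: no_smaller; exists H.
Qed.

Lemma minimal_in_DSF P :
  emb_closed P -> degseq_closed P -> DSF (minimal_in P).
Proof.
move=> P_emb P_deg; apply/DSF_contains => G H eqGH.
by rewrite !contains_minimal_in //; apply: P_deg.
Qed.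

Lemma in_minimal_DSF_singleton G : degseq_closed (emb G) -> in_minimal_DSF G.
Proof.
move=> G_deg; exists (iso G); split; last exact: iso_refl.
  by move=> H K isoHK isoGH; apply: iso_trans isoHK.
split=> [|F' F'_iso [H F'H] [subF' nsub] _].
  apply/DSF_contains => H K eqHK [L isoGL embLH].
  exists G; first exact: iso_refl.
  by apply: G_deg eqHK _; apply: emb_trans (iso_emb isoGL) embLH.
apply: nsub => K isoGK.
exact: F'_iso (iso_trans (iso_sym (subF' _ F'H)) isoGK) F'H.
Qed.

(** * Complementation *)

Section Complement.
Variable G : sgraph.

Definition compl_adj : rel G := fun x y => (x != y) && ~~ adj x y.

Lemma compl_sym : symmetric compl_adj.
Proof. by move=> x y; rewrite /compl_adj eq_sym adj_sym. Qed.

Lemma compl_irrefl : irreflexive compl_adj.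
Proof. by move=> x; rewrite /compl_adj eqxx. Qed.

Definition compl : sgraph := SGraph compl_sym compl_irrefl.

Lemma deg_compl (x : G) : @deg compl x = #|G|.-1 - deg x.
Proof.
rewrite -(cardsC1 x) -cardsDS; last first.
  by apply/subsetP => y; rewrite !inE eq_sym; apply: adj_neq.
by apply: eq_card => y; rewrite !inE /= /compl_adj eq_sym andbC.
Qed.
End Complement.

Lemma compl_compl G : iso (compl (compl G)) G.
Proof.
exists id => [|x y]; first by exists id.
rewrite /= /compl_adj /= /compl_adj negb_and !negbK.
by case: eqP => //= ->; rewrite adj_irrefl.
Qed.

Lemma emb_compl G H : emb G H -> emb (compl G) (compl H).
Proof.
move=> [f f_inj fA]; exists f => // x y.
by rewrite /= /compl_adj (inj_eq f_inj) fA.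
Qed.

Lemma iso_compl G H : iso G H -> iso (compl G) (compl H).
Proof.
move=> [f f_bij fA]; exists f => // x y.
by rewrite /= /compl_adj (bij_eq f_bij) fA.
Qed.

Lemma degseq_compl G H :
  degseq G = degseq H -> degseq (compl G) = degseq (compl H).
Proof.
move/degseqP=> [f f_bij f_deg]; apply/degseqP; exists f => // x.
by rewrite !deg_compl f_deg (bij_eq_card f_bij).
Qed.

Section ComplementOfSet.
Variable F : graph_set.
Hypothesis F_iso : iso_closed F.

Definition compl_set : graph_set := fun G => F (compl G).

Lemma compl_set_iso_closed : iso_closed compl_set.
Proof. by move=> G H /iso_compl; apply: F_iso. Qed.

Lemma contains_compl_set G : contains compl_set G <-> contains F (compl G).
Proof.
split=> [[H FH embHG]|[H FH embHG]]; exists (compl H) => //.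
- exact: emb_compl.
- exact: F_iso (iso_sym (compl_compl H)) FH.
- exact: emb_trans (emb_compl embHG) (iso_emb (compl_compl G)).
Qed.

Lemma compl_set_DSF : DSF F -> DSF compl_set.
Proof.
move/DSF_contains=> F_deg; apply/DSF_contains => G H eqGH.
by move/contains_compl_set/(F_deg _ _ (degseq_compl eqGH))/contains_compl_set.
Qed.
End ComplementOfSet.

Lemma compl_set_minimal_DSF F :
  iso_closed F -> minimal_DSF F -> minimal_DSF (compl_set F).
Proof.
move=> F_iso [dsfF minF]; split; first exact: compl_set_DSF.
move=> F' F'_iso [H F'H] [subF' nsub] dsfF'.
apply: (minF (compl_set F')); last exact: compl_set_DSF.
- exact: compl_set_iso_closed.
- by exists (compl H); apply: F'_iso (iso_sym (compl_compl H)) F'H.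
split=> [G /subF'|sub]; first exact: F_iso (compl_compl G).
by apply: nsub => G /sub; apply: F'_iso (compl_compl G).
Qed.

Lemma in_minimal_DSF_compl G : in_minimal_DSF (compl G) -> in_minimal_DSF G.
Proof.
move=> [F [F_iso minF FG]]; exists (compl_set F).
by split=> //; [apply: compl_set_iso_closed | apply: compl_set_minimal_DSF].
Qed.

(** * Graphs built from stars and matchings *)

Section DisjointUnion.
Variables G H : sgraph.

Definition disjoint_union_adj : rel (G + H) := fun u v =>
  match u, v with
  | inl x, inl y => adj x y
  | inr x, inr y => adj x y
  | _, _ => false
  end.

Lemma disjoint_union_sym : symmetric disjoint_union_adj.
Proof. by case=> [x|x] [y|y] //=; apply: adj_sym. Qed.

Lemma disjoint_union_irrefl : irreflexive disjoint_union_adj.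
Proof. by case=> x; apply: adj_irrefl. Qed.

Definition disjoint_union : sgraph :=
  SGraph disjoint_union_sym disjoint_union_irrefl.

Lemma emb_disjoint_unionl : emb G disjoint_union.
Proof. by exists (inl : G -> disjoint_union) => // x y []. Qed.

Lemma deg_disjoint_union_inl (x : G) : @deg disjoint_union (inl x) = deg x.
Proof.
rewrite [RHS]degE -(card_imset _ (@inl_inj G H)).
apply: eq_card => -[y|y]; rewrite in_nbhd.
  by rewrite (mem_imset _ _ (@inl_inj G H)) in_nbhd.
by apply/esym/imsetP => -[].
Qed.

Lemma deg_disjoint_union_inr (x : H) : @deg disjoint_union (inr x) = deg x.
Proof.
rewrite [RHS]degE -(card_imset _ (@inr_inj G H)).
apply: eq_card => -[y|y]; rewrite in_nbhd.
  by apply/esym/imsetP => -[].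
by rewrite (mem_imset _ _ (@inr_inj G H)) in_nbhd.
Qed.
End DisjointUnion.

Section Matching.
Variables (T : finType) (partner : T -> T).
Hypothesis partnerK : involutive partner.
Hypothesis partner_neq : forall x, partner x != x.

Definition matching_adj : rel T := fun x y => partner x == y.

Lemma matching_sym : symmetric matching_adj.
Proof. by move=> x y; rewrite /matching_adj inv_eq // eq_sym. Qed.

Lemma matching_irrefl : irreflexive matching_adj.
Proof. by move=> x; apply/negbTE/partner_neq. Qed.

Definition matching : sgraph := SGraph matching_sym matching_irrefl.

Lemma deg_matching (x : matching) : deg x = 1.
Proof.
rewrite -(cards1 (partner x)); apply: eq_card => y.
by rewrite !inE eq_sym.
Qed.
End Matching.

Section Stars.
Variables (I L : finType) (center : L -> I).

Definition stars_adj : rel (I + L) := fun u v =>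
  match u, v with
  | inl i, inr l | inr l, inl i => center l == i
  | _, _ => false
  end.

Lemma stars_sym : symmetric stars_adj.
Proof. by case=> [i|l] []. Qed.

Lemma stars_irrefl : irreflexive stars_adj.
Proof. by case. Qed.

Definition stars : sgraph := SGraph stars_sym stars_irrefl.

Lemma deg_stars_inl i : @deg stars (inl i) = #|[set l | center l == i]|.
Proof.
rewrite -(card_imset _ (@inr_inj I L)); apply: eq_card => -[j|l].
  by rewrite in_nbhd; apply/esym/imsetP => -[].
by rewrite (mem_imset _ _ (@inr_inj I L)) !inE.
Qed.

Lemma deg_stars_inr l : @deg stars (inr l) = 1.
Proof.
rewrite -(cards1 (inl (center l) : stars)).
by apply: eq_card => -[i|k]; rewrite !inE.
Qed.
End Stars.

Definition star_forest (G : sgraph) : Prop :=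
  forall x y : G, adj x y -> ~~ (hub x && hub y).

Lemma star_forest_stars (I L : finType) (center : L -> I) :
  star_forest (stars center).
Proof.
by move=> [i|l] [j|k] //= _; rewrite /hub deg_stars_inr ?andbF.
Qed.

Lemma star_forest_emb G H : emb G H -> star_forest H -> star_forest G.
Proof.
move=> [f f_inj fA] sfH x y xy; have /sfH : adj (f x) (f y) by rewrite fA.
by apply: contra => /andP [x_hub y_hub]; rewrite !hub_emb.
Qed.

Section StarsEmbedding.
Variables (I L : finType) (center : L -> I) (G : sgraph).
Variables (f : I -> G) (leaf : L -> G).
Hypothesis sfG : star_forest G.
Hypotheses (f_inj : injective f) (leaf_inj : injective leaf).
Hypothesis f_hub : forall i, hub (f i).
Hypothesis f_leaf : forall l, adj (f (center l)) (leaf l).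

Lemma star_leaf_nonhub l : ~~ hub (leaf l).
Proof. by have := sfG (f_leaf l); rewrite f_hub. Qed.

Lemma star_leaf_adj l x : adj x (leaf l) = (x == f (center l)).
Proof.
apply/idP/eqP => [|->]; last exact: f_leaf.
rewrite adj_sym => lx; apply: nonhub_adj_eq (star_leaf_nonhub l) lx _.
by rewrite adj_sym.
Qed.

Lemma star_center_neq_leaf i l : f i != leaf l.
Proof. by apply: contraTneq (f_hub i) => ->; apply: star_leaf_nonhub. Qed.

Lemma emb_stars : emb (stars center) G.
Proof.
exists (fun u => match u with inl i => f i | inr l => leaf l end).
  move=> [i|l] [j|k] /=.
  - by move/f_inj->.
  - by move/eqP; rewrite (negbTE (star_center_neq_leaf _ _)).
  - by move/esym/eqP; rewrite (negbTE (star_center_neq_leaf _ _)).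
  - by move/leaf_inj->.
move=> [i|l] [j|k] /=.
- by apply/negbTE/negP => /sfG; rewrite !f_hub.
- by rewrite star_leaf_adj (inj_eq f_inj) eq_sym.
- by rewrite adj_sym star_leaf_adj (inj_eq f_inj) eq_sym.
- by rewrite star_leaf_adj eq_sym (negbTE (star_center_neq_leaf _ _)).
Qed.
End StarsEmbedding.

(** * Darts *)

Section Darts.
Variable G : sgraph.

Definition dart : finType := {d : G * G | adj d.1 d.2}.

Definition dart_source (d : dart) : G := (val d).1.

Lemma dart_rev_adj (d : dart) : adj (val d).2 (val d).1.
Proof. by rewrite adj_sym (valP d). Qed.

Definition dart_rev (d : dart) : dart :=
  exist _ ((val d).2, (val d).1) (dart_rev_adj d).

Lemma dart_revK : involutive dart_rev.
Proof. by move=> d; apply/val_inj; rewrite /= -surjective_pairing. Qed.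

Lemma dart_rev_neq d : dart_rev d != d.
Proof.
apply: contraTneq (valP d) => /(congr1 (fun e => (val e).1)) /= ->.
by rewrite adj_irrefl.
Qed.

Lemma card_dart_source x : #|[set d | dart_source d == x]| = deg x.
Proof.
have target_inj :
    {in [set d | dart_source d == x] &, injective (fun d => (val d).2)}.
  move=> [[d1 d2] d_adj] [[e1 e2] e_adj]; rewrite !inE /dart_source /=.
  move=> /eqP d1x /eqP e1x eq_target; apply/val_inj.
  by rewrite /= d1x e1x eq_target.
rewrite -(card_in_imset target_inj); apply: eq_card => y; rewrite inE.
apply/imsetP/idP => [[d + ->]|xy].
  by rewrite inE => /eqP <-; apply: valP d.
by exists (exist _ (x, y) xy); rewrite ?inE /dart_source /=.
Qed.

Definition dart_matching : sgraph :=
  disjoint_union G (matching dart_revK dart_rev_neq).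

Definition dart_stars : sgraph := stars dart_source.

Lemma degseq_dart : degseq dart_matching = degseq dart_stars.
Proof.
apply/degseqP; exists id => [|[x|d]]; first by exists id.
  by rewrite deg_stars_inl card_dart_source deg_disjoint_union_inl.
by rewrite deg_stars_inr deg_disjoint_union_inr deg_matching.
Qed.
End Darts.

(** * Vertices near hubs *)

Definition near_hub (G : sgraph) (x : G) : bool :=
  [exists y, hub y && ((x == y) || adj x y)].

Definition hub_dominated (G : sgraph) : Prop := forall x : G, near_hub x.

Lemma near_hubP (G : sgraph) (x : G) :
  reflect (exists2 y, hub y & (x == y) || adj x y) (near_hub x).
Proof. exact: exists_inP. Qed.

Lemma hub_near_hub (G : sgraph) (x : G) : hub x -> near_hub x.
Proof. by move=> x_hub; apply/near_hubP; exists x; rewrite ?eqxx. Qed.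

Lemma near_hub_emb (G H : sgraph) (f : G -> H) x :
  injective f -> {mono f : x y / adj x y} -> near_hub x -> near_hub (f x).
Proof.
move=> f_inj fA /near_hubP [y y_hub xy]; apply/near_hubP; exists (f y).
  exact: hub_emb.
by rewrite (inj_eq f_inj) fA.
Qed.

Lemma near_hub_disjoint_union (G H : sgraph) (u : disjoint_union G H) :
  (forall y : H, ~~ hub y) -> near_hub u -> exists x, u == inl x.
Proof.
move=> H_nonhub; case: u => [x _|z]; first by exists x.
case/near_hubP=> -[x|y]; rewrite ?orbF //.
by rewrite /hub deg_disjoint_union_inr => /(negP (H_nonhub y)).
Qed.

Lemma emb_disjoint_union (G H K : sgraph) :
  (forall y : H, ~~ hub y) -> hub_dominated K ->
  emb K (disjoint_union G H) -> emb K G.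
Proof.
move=> H_nonhub K_dom [h h_inj hA].
have h_inl x : exists y, h x == inl y.
  exact: near_hub_disjoint_union H_nonhub (near_hub_emb h_inj hA (K_dom x)).
pose f x := xchoose (h_inl x).
have hE x : h x = inl (f x) by apply/eqP/(xchooseP (h_inl x)).
exists f => x y; first by move=> eq_f; apply: h_inj; rewrite !hE eq_f.
by rewrite -hA !hE.
Qed.

(* Across the two parts, the complement has all edges; so every vertex of one
   part is adjacent to the whole other part. *)
Lemma hub_dominated_compl (G : sgraph) (C : {set G}) :
  2 < #|G| -> 0 < #|C| -> 0 < #|~: C| ->
  (forall x y, x \in C -> y \notin C -> ~~ adj x y) ->
  hub_dominated (compl G).
Proof.
move=> G_gt2; wlog C_gt1 : C / 1 < #|C| => [hwlog C_gt0 D_gt0 noncross|].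
  have [C_gt1|C_le1] := ltnP 1 #|C|; first exact: (hwlog C).
  apply: (hwlog (~: C)); rewrite ?setCK //.
    by rewrite -(ltn_add2l #|C|) cardsC (leq_ltn_trans _ G_gt2) // addn1 ltnS.
  by move=> x y; rewrite !inE negbK adj_sym => ? ?; apply: noncross.
move=> _ /card_gt0P [z]; rewrite inE => zC noncross.
have cross x y : x \in C -> y \notin C -> @adj (compl G) y x.
  move=> xC yC; rewrite /= /compl_adj adj_sym noncross // andbT.
  by apply: contraNneq yC => ->.
have outside_hub y : y \notin C -> @hub (compl G) y.
  move=> yC; apply: leq_trans C_gt1 _; apply/subset_leq_card/subsetP => x xC.
  by rewrite inE cross.
move=> x; have [xC|xC] := boolP (x \in C); last exact/hub_near_hub/outside_hub.
apply/near_hubP; exists z; first exact: outside_hub.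
by rewrite (@adj_sym (compl G)) cross ?orbT.
Qed.

Lemma hub_dominated_or_compl (G : sgraph) :
  2 < #|G| -> hub_dominated G \/ hub_dominated (compl G).
Proof.
move=> G_gt2; have [/forallP|/forallPn [x far_x]] :=
  boolP [forall x : G, near_hub x]; [by left | right].
have nonhub y : (x == y) || adj x y -> ~~ hub y.
  by move=> xy; apply: contraNN far_x => y_hub; apply/near_hubP; exists y.
have x_nonhub : ~~ hub x by rewrite nonhub ?eqxx.
apply: (@hub_dominated_compl G (x |: nbhd x)) => //.
- by apply/card_gt0P; exists x; rewrite setU11.
- rewrite cardsCs setCK subn_gt0 (leq_ltn_trans _ G_gt2) //.
  by rewrite cardsU1 (leq_add (leq_b1 _)) // leqNgt.
move=> y z; rewrite !inE negb_or => y_near /andP [zx xz].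
case/orP: y_near => [/eqP -> //|xy]; apply: contraNN zx => yz.
have yx : adj y x by rewrite adj_sym.
by rewrite (nonhub_adj_eq (nonhub y _) yz yx) ?xy ?orbT.
Qed.

(** * Graphs whose degrees dominate given thresholds *)

Section DegreeDomination.
Variables (I : finType) (g : I -> nat).

Definition deg_dominates : graph_set := fun G =>
  exists2 f : I -> G, injective f & forall i, g i <= deg (f i).

Lemma deg_dominates_emb : emb_closed deg_dominates.
Proof.
move=> G H [h h_inj hA] [f f_inj gf]; exists (h \o f); first exact: inj_comp.
by move=> i; apply: leq_trans (gf i) (leq_deg_emb h_inj hA _).
Qed.

Lemma deg_dominates_degseq : degseq_closed deg_dominates.
Proof.
move=> G H /degseqP [h h_bij h_deg] [f f_inj gf].
exists (h \o f) => [|i /=]; last by rewrite h_deg.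
exact: inj_comp (bij_inj h_bij) f_inj.
Qed.

Definition threshold_stars : sgraph :=
  @stars I {i : I & 'I_(g i)} tag.

Lemma deg_dominates_stars : deg_dominates threshold_stars.
Proof.
exists (inl : I -> threshold_stars) => [|i]; first exact: inl_inj.
have Tagged_inj := @eq_from_Tagged I (fun j => 'I_(g j)) i.
rewrite deg_stars_inl -[g i]card_ord -(card_imset predT Tagged_inj).
by apply/subset_leq_card/subsetP => _ /imsetP [k _ ->]; rewrite inE.
Qed.

Hypothesis g_gt1 : forall i, 1 < g i.

Lemma threshold_stars_emb G :
  star_forest G -> deg_dominates G -> emb threshold_stars G.
Proof.
move=> sfG [f f_inj gf].
have f_hub i : hub (f i) := leq_trans (g_gt1 i) (gf i).
pose leaf (l : {i : I & 'I_(g i)}) : G :=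
  enum_val (widen_ord (gf (tag l)) (tagged l)).
have f_leaf l : adj (f (tag l)) (leaf l).
  by have := enum_valP (widen_ord (gf (tag l)) (tagged l)); rewrite in_nbhd.
apply: (emb_stars sfG f_inj _ f_hub f_leaf) => l m eq_leaf.
have /eqP/f_inj eq_tag : f (tag l) == f (tag m).
  by rewrite -(star_leaf_adj sfG f_hub f_leaf) -eq_leaf f_leaf.
case: l m eq_tag eq_leaf {f_leaf} => i k [j l] /= eq_ij.
by case: j / eq_ij l => l /enum_val_inj /(congr1 val) /= /val_inj ->.
Qed.

Lemma minimal_star_forest_iso G :
  star_forest G -> minimal_in deg_dominates G -> iso threshold_stars G.
Proof.
move=> sfG minG; have embG := threshold_stars_emb sfG minG.1.
exact: minimal_in_iso deg_dominates_stars embG minG.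
Qed.

(* The vertices that are not near a hub can be deleted without changing the
   degree of any hub. *)
Lemma minimal_hub_dominated G :
  minimal_in deg_dominates G -> hub_dominated G.
Proof.
move=> [[f f_inj gf] minG]; pose S := [set x : G | near_hub x].
have f_hub i : hub (f i) := leq_trans (g_gt1 i) (gf i).
have fS i : f i \in S by rewrite inE hub_near_hub.
have S_dom : deg_dominates (induced S).
  exists (fun i => exist _ (f i) (fS i) : induced S) => [i j [] /f_inj //|i].
  rewrite -deg_induced //; apply/subsetP => y; rewrite !inE => fy.
  by apply/near_hubP; exists (f i); rewrite // adj_sym fy orbT.
have leGS : #|G| <= #|S|.
  by rewrite -[#|S|]card_sig; apply: minG (induced_emb S) S_dom.
have /eqP/setP S_full : S == setT by rewrite eqEcard subsetT cardsT.
by move=> x; have := S_full x; rewrite !inE.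
Qed.

Lemma deg_dominates_minimal_DSF : minimal_DSF (minimal_in deg_dominates).
Proof.
split; first exact: minimal_in_DSF deg_dominates_emb deg_dominates_degseq.
move=> F' F'_iso [H F'H] [subF' nsub] /DSF_contains F'_deg.
have F'_stars : F' threshold_stars.
  have [K F'K embK] : contains F' (dart_stars H).
    apply: F'_deg (degseq_dart H) _.
    by exists H => //; apply: emb_disjoint_unionl.
  have sfK := star_forest_emb embK (@star_forest_stars _ _ (@dart_source H)).
  exact: F'_iso (iso_sym (minimal_star_forest_iso sfK (subF' _ F'K))) F'K.
apply: nsub => G minG.
have [K F'K embK] : contains F' (dart_matching G).
  apply: F'_deg (esym (degseq_dart G)) _; exists threshold_stars => //.
  apply: threshold_stars_emb; first exact: star_forest_stars.
  apply: deg_dominates_degseq (degseq_dart G) _.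
  exact: deg_dominates_emb (emb_disjoint_unionl _ _) minG.1.
have minK := subF' _ F'K.
have embKG : emb K G.
  apply: emb_disjoint_union (minimal_hub_dominated minK) embK => d.
  by rewrite /hub deg_matching.
exact: F'_iso (minimal_in_iso minK.1 embKG minG) F'K.
Qed.
End DegreeDomination.

Lemma inj_leq_eq (I : finType) (g : I -> nat) (c : I -> I) :
  injective c -> (forall i, g i <= g (c i)) -> forall i, g (c i) = g i.
Proof.
move=> c_inj le_g i.
have [_] := leqif_sum (fun i (_ : true) => leqif_eq (le_g i)).
by rewrite (reindex_inj c_inj) eqxx => /esym /forallP /(_ i) /eqP ->.
Qed.

Definition hub_degree (G : sgraph) (v : {x : G | hub x}) : nat := deg (val v).

Lemma hub_dominated_minimal G :
  hub_dominated G -> minimal_in (deg_dominates (@hub_degree G)) G.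
Proof.
move=> G_dom; split; first by exists val => //; apply: val_inj.
move=> H [h h_inj hA] [f f_inj degf].
have le_h v : hub_degree v <= deg (h (f v)).
  exact: leq_trans (degf v) (leq_deg_emb h_inj hA _).
have hf_hub v : hub (h (f v)) := leq_trans (valP v) (le_h v).
pose c v : {x : G | hub x} := exist _ (h (f v)) (hf_hub v).
have c_inj : injective c by move=> v w /(congr1 val) /= /h_inj /f_inj.
have deg_c v : hub_degree (c v) = hub_degree v by apply: inj_leq_eq c_inj _ v.
have hub_image y : hub y -> exists2 z, y = h z & deg (h z) = deg z.
  move=> y_hub; have [c' _ c'K] := injF_bij c_inj.
  pose v := c' (exist _ y y_hub); exists (f v).
    by have /(congr1 val) /= := c'K (exist _ y y_hub).
  apply/eqP; rewrite eqn_leq leq_deg_emb // andbT.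
  by apply: leq_trans (degf v); rewrite -[hub_degree v]deg_c.
rewrite -(card_imset predT h_inj); apply/subset_leq_card/subsetP => x _.
have /near_hubP [_ /hub_image [z -> deg_z]] := G_dom x.
case/orP=> [/eqP -> |]; first exact: imset_f.
rewrite adj_sym -in_nbhd -(imset_nbhd h_inj hA deg_z) => /imsetP [w _ ->].
exact: imset_f.
Qed.

Lemma in_minimal_DSF_hub_dominated G : hub_dominated G -> in_minimal_DSF G.
Proof.
move=> G_dom; exists (minimal_in (deg_dominates (@hub_degree G))); split.
- exact/minimal_in_iso_closed/deg_dominates_emb.
- by apply: deg_dominates_minimal_DSF => v; apply: valP v.
- exact: hub_dominated_minimal.
Qed.

(** * Graphs on at most two vertices *)

Lemma in_minimal_DSF_card_le1 (G : sgraph) : #|G| <= 1 -> in_minimal_DSF G.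
Proof.
move=> /card_le1_eqP G_eq; apply: in_minimal_DSF_singleton => H K.
move=> /degseqP [h h_bij _] [f f_inj _]; exists (h \o f) => [|x y].
  exact: inj_comp (bij_inj h_bij) f_inj.
by rewrite (G_eq x y isT isT) !adj_irrefl.
Qed.

Lemma emb_edge (G H : sgraph) (a b : G) (u v : H) :
  #|G| = 2 -> adj a b -> adj u v -> emb G H.
Proof.
move=> G2 ab uv; have neq_ab := adj_neq ab; have neq_uv := adj_neq uv.
have abP (x : G) : x = a \/ x = b.
  have /eqP/setP/(_ x) : [set a; b] == setT.
    by rewrite eqEcard subsetT cardsT G2 cards2 neq_ab.
  by rewrite !inE => /orP [] /eqP; [left | right].
have ba_neq : (b == a) = false by rewrite eq_sym (negbTE neq_ab).
exists (fun x => if x == a then u else v) => x y;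
  case: (abP x) (abP y) => -> [] ->; rewrite ?eqxx ?ba_neq ?adj_irrefl //.
- by move/eqP; rewrite (negbTE neq_uv).
- by move/esym/eqP; rewrite (negbTE neq_uv).
- by rewrite ab uv.
- by rewrite ![adj _ a]adj_sym [adj v _]adj_sym ab uv.
Qed.

Lemma in_minimal_DSF_edge (G : sgraph) (a b : G) :
  #|G| = 2 -> adj a b -> in_minimal_DSF G.
Proof.
move=> G2 ab; apply: in_minimal_DSF_singleton => H K.
move=> /degseqP [h _ h_deg] [f _ fA].
have /deg_gt0P [v hv] : 0 < deg (h (f a)).
  by rewrite h_deg; apply/deg_gt0P; exists (f b); rewrite fA.
exact: emb_edge G2 ab hv.
Qed.

Theorem theorem2p12 (G : sgraph) :
  exists F : graph_set, [/\ iso_closed F, minimal_DSF F & F G].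
Proof.
case: (ltngtP #|G| 2) => [G_lt2|G_gt2|G2]; first exact: in_minimal_DSF_card_le1.
  case: (hub_dominated_or_compl G_gt2) => /in_minimal_DSF_hub_dominated //.
  exact: in_minimal_DSF_compl.
have /eqP/cards2P [a [b [neq_ab _]]] : #|[set: G]| = 2 by rewrite cardsT.
have [ab|nab] := boolP (adj a b); first exact: in_minimal_DSF_edge G2 ab.
apply/in_minimal_DSF_compl/(@in_minimal_DSF_edge (compl G) a b G2).
by rewrite /= /compl_adj neq_ab.
Qed.
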